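(* For $k>0$ let $F_k^*(t)=\min\{k\,\mathrm{chd}\,t,\ 1\}$ for $t\in[0,\pi]$, where $\mathrm{chd}\,t=2\sin(t/2)$. For every $\varepsilon\in(0,\pi/2)$ there exist $k\ge1$ and $\delta>0$ such that for every spherical triangle $\Delta$ of circumscribed radius at most $\pi/2-\varepsilon$ the angle distortion by $F_k^*$ satisfies $$D(F_k^*,\Delta)\ge\frac13+\delta.$$
   Context: Triangles always have angles strictly between $0$ and $\pi$; a spherical triangle is a triangle isometric to a (geodesic) triangle on the unit sphere in $\mathbb{R}^3$; its circumscribed radius is the spherical radius of the spherical disc that contains it and is bounded by the circle through its vertices. If $\Delta$ is a spherical or Euclidean triangle with side lengths $a,b,c$ and $F$ is a subadditive increasing (nondecreasing) function with $F(0)=0$ and $F(t)>0$ for $t>0$, then $F\Delta$ denotes the Euclidean triangle with side lengths $F(a),F(b),F(c)$. If $\alpha,\beta,\gamma$ are the angles of $\Delta$ and $\tilde\alpha,\tilde\beta,\tilde\gamma$ the corresponding angles of $F\Delta$ (i.e. opposite to the corresponding sides), the angle distortion is $D(F,\Delta)=\min\{\tilde\alpha/\alpha,\tilde\beta/\beta,\tilde\gamma/\gamma\}$. *)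

(* Defs.v *)
From mathcomp Require Import all_boot all_order all_algebra.
From mathcomp Require Import all_classical all_reals all_analysis.

Set Implicit Arguments.
Unset Strict Implicit.
Unset Printing Implicit Defensive.

Import Order.TTheory GRing.Theory Num.Theory.
Local Open Scope ring_scope.

Definition dotv {R : realType} {n : nat} (u v : 'rV[R]_n) : R :=
  \sum_(i < n) u 0 i * v 0 i.

(* The norm `|u| that MathComp-Analysis puts on row vectors is the sup norm. *)
Definition norm2 {R : realType} {n : nat} (u : 'rV[R]_n) : R :=
  Num.sqrt (dotv u u).

Definition vangle {R : realType} {n : nat} (u v : 'rV[R]_n) : R :=
  acos (dotv u v / (norm2 u * norm2 v)).

(* The vertices; the sides are the geodesic segments joining them. *)
Record triangle (R : realType) (n : nat) := Triangle {
  vA : 'rV[R]_n;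
  vB : 'rV[R]_n;
  vC : 'rV[R]_n
}.

Definition edist {R : realType} {n : nat} (X Y : 'rV[R]_n) : R := norm2 (X - Y).

Definition eangle {R : realType} {n : nat} (X Y Z : 'rV[R]_n) : R :=
  vangle (Y - X) (Z - X).

Definition euclidean_triangle {R : realType} (T : triangle R 2) : Prop :=
  let: Triangle A B C := T in
  [/\ A != B, B != C & C != A] /\
  [/\ 0 < eangle A B C < pi, 0 < eangle B C A < pi & 0 < eangle C A B < pi].

Definition on_sphere {R : realType} (X : 'rV[R]_3) : Prop := norm2 X = 1.

(* Only meaningful for points on the unit sphere. *)
Definition sdist {R : realType} (X Y : 'rV[R]_3) : R := acos (dotv X Y).

(* Y - <X,Y> X is the component of Y orthogonal to X, which is tangent at X to
   the minimal geodesic from X to Y. *)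
Definition sangle {R : realType} (X Y Z : 'rV[R]_3) : R :=
  vangle (Y - dotv X Y *: X) (Z - dotv X Z *: X).

(* Vertices at distance strictly between 0 and pi are joined by a unique minimal
   geodesic. *)
Definition spherical_triangle {R : realType} (T : triangle R 3) : Prop :=
  let: Triangle A B C := T in
  [/\ on_sphere A, on_sphere B & on_sphere C] /\
  [/\ 0 < sdist A B < pi, 0 < sdist B C < pi & 0 < sdist C A < pi] /\
  [/\ 0 < sangle A B C < pi, 0 < sangle B C A < pi & 0 < sangle C A B < pi].

(* The closed region bounded by the sides: the part of the sphere in the convex
   cone spanned by the vertices. *)
Definition in_spherical_triangle {R : realType} (T : triangle R 3)
    (X : 'rV[R]_3) : Prop :=
  on_sphere X /\
  exists a b c : R, [/\ 0 <= a, 0 <= b, 0 <= c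
                     & X = a *: vA T + b *: vB T + c *: vC T].

(* There are two discs bounded by the circle through the vertices, with opposite
   centres N and radii r and pi - r; the inclusion selects one of them. *)
Definition circumscribed_radius {R : realType} (T : triangle R 3) (r : R) : Prop :=
  exists N : 'rV[R]_3,
    [/\ on_sphere N,
        [/\ sdist N (vA T) = r, sdist N (vB T) = r & sdist N (vC T) = r]
      & forall X, in_spherical_triangle T X -> sdist N X <= r].

(* E is F T; it is determined up to a congruence preserving the labels. *)
Definition image_triangle {R : realType} (F : R -> R) (T : triangle R 3)
    (E : triangle R 2) : Prop :=
  euclidean_triangle E /\
  [/\ edist (vB E) (vC E) = F (sdist (vB T) (vC T)),
      edist (vC E) (vA E) = F (sdist (vC T) (vA T))
    & edist (vA E) (vB E) = F (sdist (vA T) (vB T))].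

(* The smallest ratio between corresponding angles of E = F T and T. *)
Definition angle_distortion {R : realType} (T : triangle R 3) (E : triangle R 2) : R :=
  Num.min (eangle (vA E) (vB E) (vC E) / sangle (vA T) (vB T) (vC T))
    (Num.min (eangle (vB E) (vC E) (vA E) / sangle (vB T) (vC T) (vA T))
             (eangle (vC E) (vA E) (vB E) / sangle (vC T) (vA T) (vB T))).

Definition chd {R : realType} (t : R) : R := 2 * sin (t / 2).

(* Used for t in [0, pi] only. *)
Definition Fstar {R : realType} (k t : R) : R := Num.min (k * chd t) 1.

(* Main.v *)
Require Import Defs.
From mathcomp Require Import all_boot all_order all_algebra.
From mathcomp Require Import all_classical all_reals all_analysis.
From mathcomp Require Import ring lra.

Import Order.TTheory GRing.Theory Num.Theory.
Import numFieldNormedType.Exports.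
Local Open Scope ring_scope.

(** Work with dot products: with [d], [e], [f] the pairwise dot products of the
    vertices, the chord of a side is [sqrt (2 - 2 d)], so [F T] is the chordal
    triangle of [T] scaled by [k] and truncated at [1].  If the circumscribed
    radius is [r], then [s = sin eps <= cos r]; take [k = 2 / s].
    - Side of scaled chord [>= 1].  It is a longest side of [F T], so the angle
      opposite to it in [F T] is at least [pi / 3].  The determinant of the
      vertices is [cos r] times twice the area of the chordal triangle, which
      bounds the sine of the spherical angle below by [s ^+ 2 / 4] and keeps the
      angle away from [pi].
    - Side of scaled chord [<= 1].  The spherical and planar cosine formulas give
      [1 - cos b >= 9 / 16 * (1 - cos a)] for the angle [a] of [T] and [b] of
      [F T], hence [b / a >= 3 / 8 > 1 / 3] because [x / 2 <= sin x <= x] on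
      [[0, pi / 2]]. *)

(** * Trigonometric estimates *)

Lemma ler_cos (R : realType) (a b : R) :
  0 <= a <= pi -> 0 <= b <= pi -> (cos b <= cos a) = (a <= b).
Proof.
by move=> ha hb; rewrite !leNgt ltr_cos // in_itv.
Qed.

(** The mean value theorem gives [sin x = x * cos c] with [c] between [0] and [x], and [cos]
    decreases on [[0, pi]]. *)
Lemma sin_bounds (R : realType) (x : R) : 0 <= x <= pi ->
  x * cos x <= sin x <= x.
Proof.
move=> /andP[x0 xpi].
have [|c] := @MVT_segment R sin cos 0 x x0.
  exact/continuous_subspaceT/continuous_sin.
rewrite in_itv /= => /andP[c0 cx]; rewrite sin0 !subr0 => ->.
rewrite mulrC ler_wpM2r //= ?ler_piMl ?cos_le1 //.
by rewrite ler_cos ?x0 ?c0 //= (le_trans cx).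
Qed.

(** Doubling the angle, [sin x = 2 sin (x / 2) cos (x / 2) >= x cos (x / 2) ^ 2 = x (1 + cos x) /
    2]. *)
Lemma half_le_sin (R : realType) (x : R) : 0 <= x <= pi / 2 -> x / 2 <= sin x.
Proof.
move=> /andP[x0 x1].
have pi0 := pi_gt0 R.
have /andP[h _] : (x / 2) * cos (x / 2) <= sin (x / 2) <= x / 2.
  by apply: sin_bounds; lra.
have c0 : 0 <= cos x by apply: cos_ge0_pihalf; lra.
have c1 : 0 <= cos (x / 2) by apply: cos_ge0_pihalf; lra.
have xE : x = (x / 2) *+ 2 by rewrite mulr2n; lra.
have := cos_mulr2n (x / 2); have := sin_mulr2n (x / 2); rewrite -xE => sE cE.
nra.
Qed.

Lemma cos_half (R : realType) (t : R) : 1 - cos t = 2 * sin (t / 2) ^+ 2.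
Proof.
have tE : t = (t / 2) *+ 2 by rewrite mulr2n; lra.
rewrite {1}tE cos_mulr2n sin2cos2; ring.
Qed.

Lemma cos_pi3 (R : realType) : cos (pi / 3 : R) = 1 / 2.
Proof.
have pi0 := pi_gt0 R.
have c0 : 0 < cos (pi / 3 : R) by apply: cos_gt0_pihalf; lra.
have piE : (pi : R) = (pi / 3) *+ 2 + pi / 3 by rewrite mulr2n; lra.
have := cospi R; rewrite {1}piE cosD cos_mulr2n sin_mulr2n.
have := cos2Dsin2 (pi / 3 : R).
set c := cos _ in c0 *; set s := sin _ => h1 h2.
(* The triple-angle formula [4 c ^ 3 - 3 c = -1], factored; [c > 0] leaves only [c = 1 / 2]. *)
have : (c + 1) * (2 * c - 1) ^+ 2 = 0.
  have -> : (c + 1) * (2 * c - 1) ^+ 2 =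
    ((c ^+ 2 *+ 2 - 1) * c - c * s *+ 2 * s) + 1 + 2 * c * (c ^+ 2 + s ^+ 2 - 1).
    ring.
  rewrite h1 h2; ring.
move=> /eqP; rewrite mulf_eq0 sqrf_eq0 => /orP[] /eqP; lra.
Qed.

(** Taking square roots in half angles gives [3 / 4 * sin (a / 2) <= sin (b / 2)]; then
    [sin (a / 2) >= a / 4] and [sin (b / 2) <= b / 2]. *)
Lemma versine_ratio (R : realType) (a b : R) :
  0 <= a <= pi -> 0 <= b <= pi ->
  9 / 16 * (1 - cos a) <= 1 - cos b -> 3 / 8 * a <= b.
Proof.
move=> /andP[a0 a1] /andP[b0 b1]; rewrite !cos_half => h.
have pi0 := pi_gt0 R.
have ha : a / 2 / 2 <= sin (a / 2) by apply: half_le_sin; lra.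
have /andP[_ hb] : (b / 2) * cos (b / 2) <= sin (b / 2) <= b / 2.
  by apply: sin_bounds; lra.
have sb0 : 0 <= sin (b / 2) by apply: sin_ge0_pi; lra.
have : 3 / 4 * sin (a / 2) <= sin (b / 2).
  rewrite -ler_sqr ?nnegrE //; [rewrite exprMn; lra | lra].
lra.
Qed.

(** * Inequalities for chords and truncated chords *)

Lemma sqr_minB_le (R : realType) (u v : R) :
  (Num.min u 1 - Num.min v 1) ^+ 2 <= (u - v) ^+ 2.
Proof.
rewrite !minEle; have := sqr_ge0 (u - v).
by case: (leP u 1) => hu; case: (leP v 1) => hv; nra.
Qed.

(** Here [x] is a chord and [m] the cosine of half the side; the bound on [x ^+ 2] says [s <= m]. If
    [m >= 3 / 4], the minimum is at most [k * x]; otherwise [x >= 1] and [k * m >= k * s = 2], while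
    the minimum is at most [1]. *)
Lemma trunc_factor (R : realType) (k s x m : R) :
  0 < s <= 1 -> k * s = 2 -> 0 < x -> 0 < m -> m ^+ 2 = 1 - x ^+ 2 / 4 ->
  x ^+ 2 <= 4 * (1 - s ^+ 2) ->
  3 / 4 * Num.min (k * x) 1 <= k * x * m.
Proof.
move=> /andP[s0 s1] ks x0 m0 mE xs.
have k2 : 2 <= k by nra.
have sm : s <= m by rewrite -ler_sqr ?nnegrE ?mE; lra.
have kx0 : 0 < k * x by nra.
case: (leP (3 / 4) m) => hm.
  have : Num.min (k * x) 1 <= k * x by rewrite ge_min lexx.
  nra.
have x1 : 1 <= x by rewrite -ler_sqr ?nnegrE; nra.
have km : 2 <= k * m by nra.
have : Num.min (k * x) 1 <= 1 by rewrite ge_min lexx orbT.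
nra.
Qed.

(** Heron's polynomial is [(x + y + z) (x + y - z) (x - y + z) (y - x + z)], and only the second
    factor can be nonpositive when [z >= x + y]. *)
Lemma heron_lt_add (R : realType) (x y z : R) :
  0 < x -> 0 < y -> 0 < z ->
  0 < 2 * (x ^+ 2 * y ^+ 2 + y ^+ 2 * z ^+ 2 + z ^+ 2 * x ^+ 2)
      - (x ^+ 4 + y ^+ 4 + z ^+ 4) ->
  z < x + y.
Proof.
move=> x0 y0 z0 h; rewrite ltNge; apply/negP => hz.
suff : 0 <= (x + y + z) * (z - x - y) * ((x - y + z) * (y - x + z)) by lra.
by rewrite !mulr_ge0 //; lra.
Qed.

Lemma law_of_cosines_lt1 (R : realType) (x y z : R) :
  0 < x -> 0 < y -> z < x + y -> x < y + z -> y < x + z ->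
  -1 < (x ^+ 2 + y ^+ 2 - z ^+ 2) / (2 * (x * y)) < 1.
Proof.
move=> x0 y0 hz hx hy.
have xy0 : 0 < x * y by rewrite mulr_gt0.
have h1 : 0 < (x + y - z) * (x + y + z) by rewrite mulr_gt0; lra.
have h2 : 0 < (y + z - x) * (x + z - y) by rewrite mulr_gt0; lra.
by rewrite ltr_pdivlMr ?ltr_pdivrMr; lra.
Qed.

Lemma min1_lt_add (R : realType) (x y z : R) :
  0 < x -> 0 < y -> z < x + y -> Num.min z 1 < Num.min x 1 + Num.min y 1.
Proof.
move=> x0 y0 h; rewrite !minEle.
by case: (leP x 1); case: (leP y 1); case: (leP z 1); lra.
Qed.

(* [x], [y], [z] are the chords of the sides; [m], [n] are the cosines of half the
   sides with chords [x], [y]. *)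
Lemma spherical_versine_le (R : realType) (x y z m n : R) :
  0 < x -> 0 < y -> 0 < m -> 0 < n ->
  m ^+ 2 = 1 - x ^+ 2 / 4 -> n ^+ 2 = 1 - y ^+ 2 / 4 ->
  1 - ((1 - z ^+ 2 / 2) - (1 - x ^+ 2 / 2) * (1 - y ^+ 2 / 2)) / (x * m * (y * n))
    <= (z ^+ 2 - (x - y) ^+ 2) / (2 * (x * m * (y * n))).
Proof.
move=> x0 y0 m0 n0 mE nE.
have D0 : 0 < x * m * (y * n) by rewrite !mulr_gt0.
have xy0 : 0 < x * y by rewrite mulr_gt0.
(* For sides [p], [q] this says [cos ((p - q) / 2) <= 1]. *)
have mn : m * n <= 1 - x * y / 4.
  by have := sqr_ge0 (m - n); have := sqr_ge0 (x - y); lra.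
have : x * y * (m * n) <= x * y * (1 - x * y / 4) by rewrite ler_pM2l.
move=> h; rewrite -subr_ge0.
set P := (X in 0 <= X).
have -> : P = (x * y * (1 - x * y / 4) - x * y * (m * n)) / (x * m * (y * n)).
  by rewrite /P; field; rewrite !gt_eqF.
by apply: divr_ge0; lra.
Qed.

(** The right side is [((k z) ^ 2 - (X - Y) ^ 2) / (2 X Y)]. Its numerator is at least [k ^ 2] times
    the one on the left, and multiplying [hx] by [hy] compares the denominators. *)
Lemma contracted_versine_ge (R : realType) (k x y z X Y m n : R) :
  0 < x -> 0 < y -> 0 < m -> 0 < n -> 0 < X -> 0 < Y ->
  3 / 4 * X <= k * x * m -> 3 / 4 * Y <= k * y * n ->
  (X - Y) ^+ 2 <= k ^+ 2 * (x - y) ^+ 2 -> (x - y) ^+ 2 <= z ^+ 2 ->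
  9 / 16 * ((z ^+ 2 - (x - y) ^+ 2) / (2 * (x * m * (y * n))))
    <= 1 - (X ^+ 2 + Y ^+ 2 - (k * z) ^+ 2) / (2 * (X * Y)).
Proof.
move=> x0 y0 m0 n0 X0 Y0 hx hy hW hz.
have D0 : 0 < x * m * (y * n) by rewrite !mulr_gt0.
have XY0 : 0 < X * Y by rewrite mulr_gt0.
have hXY : 9 / 16 * (X * Y) <= k ^+ 2 * (x * m * (y * n)).
  have -> : 9 / 16 * (X * Y) = (3 / 4 * X) * (3 / 4 * Y) by field.
  have -> : k ^+ 2 * (x * m * (y * n)) = (k * x * m) * (k * y * n) by ring.
  by apply: ler_pM => //; lra.
set W := z ^+ 2 - (x - y) ^+ 2.
have W0 : 0 <= W by rewrite subr_ge0.
have -> : 1 - (X ^+ 2 + Y ^+ 2 - (k * z) ^+ 2) / (2 * (X * Y)) =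
   ((k * z) ^+ 2 - (X - Y) ^+ 2) / (2 * (X * Y)).
  by field; rewrite !gt_eqF.
apply: (@le_trans _ _ (k ^+ 2 * W / (2 * (X * Y)))); last first.
  by rewrite ler_pM2r ?invr_gt0; rewrite /W; nra.
rewrite [leLHS]mulrA ler_pdivrMr; last by lra.
rewrite [leRHS]mulrAC ler_pdivlMr; last by lra.
have := ler_wpM2l W0 hXY; lra.
Qed.

Lemma spherical_sqr_sin (R : realType) (d e f : R) :
  -1 < e < 1 -> -1 < f < 1 ->
  1 - ((d - e * f) / (Num.sqrt (1 - e ^+ 2) * Num.sqrt (1 - f ^+ 2))) ^+ 2
    = (1 + 2 * d * e * f - d ^+ 2 - e ^+ 2 - f ^+ 2)
      / ((1 - e ^+ 2) * (1 - f ^+ 2)).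
Proof.
move=> he hf.
have e0 : 0 < 1 - e ^+ 2 by nra.
have f0 : 0 < 1 - f ^+ 2 by nra.
rewrite exprMn exprVn exprMn !sqr_sqrtr ?ltW //.
by field; rewrite !gt_eqF.
Qed.

Lemma sqr_lt1_bounds (R : realType) (c : R) : 0 < 1 - c ^+ 2 -> -1 < c < 1.
Proof. by move=> h; apply/andP; split; nra. Qed.

(** A long side has [1 - d >= 1 / (2 k ^ 2) = s ^ 2 / 8], so the Gram bound makes the squared sine
    of the angle at least [s ^ 4 / 16]; and [sin a = sin (pi - a) <= pi - a]. *)
Lemma spherical_angle_far_from_pi (R : realType) (k s d e f : R) :
  0 < s <= 1 -> k * s = 2 -> -1 < d < 1 -> -1 < e < 1 -> -1 < f < 1 ->
  2 * s ^+ 2 * ((1 - d) * (1 - e) * (1 - f))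
    <= 1 + 2 * d * e * f - d ^+ 2 - e ^+ 2 - f ^+ 2 ->
  1 <= k ^+ 2 * (2 - 2 * d) ->
  acos ((d - e * f) / (Num.sqrt (1 - e ^+ 2) * Num.sqrt (1 - f ^+ 2)))
    <= pi - s ^+ 2 / 4.
Proof.
move=> /andP[s0 s1] ks hd he hf hG hk.
have := spherical_sqr_sin R d e f he hf.
set c := _ / (Num.sqrt _ * _) => cE.
have e0 : 0 < 1 - e ^+ 2 by nra.
have f0 : 0 < 1 - f ^+ 2 by nra.
have ef0 : 0 < (1 - e) * (1 - f) by rewrite mulr_gt0; lra.
have d1 : s ^+ 2 / 8 <= 1 - d.
  have : s ^+ 2 * 1 <= s ^+ 2 * (k ^+ 2 * (2 - 2 * d)) by rewrite ler_wpM2l ?sqr_ge0.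
  by rewrite mulrA -exprMn [s * k]mulrC ks; lra.
have hs : s ^+ 4 / 16 <= 1 - c ^+ 2.
  rewrite cE ler_pdivlMr ?mulr_gt0 //; apply: le_trans hG.
  have -> : (1 - e ^+ 2) * (1 - f ^+ 2) =
     ((1 - e) * (1 - f)) * ((1 + e) * (1 + f)) by ring.
  have -> : 2 * s ^+ 2 * ((1 - d) * (1 - e) * (1 - f)) =
     ((1 - e) * (1 - f)) * (2 * s ^+ 2 * (1 - d)) by ring.
  rewrite mulrCA ler_pM2l //.
  have h4 : (1 + e) * (1 + f) <= 4 by nra.
  have h5 : s ^+ 2 * (s ^+ 2 / 8) <= s ^+ 2 * (1 - d).
    by rewrite ler_wpM2l ?sqr_ge0.
  have h6 : s ^+ 4 / 16 * ((1 + e) * (1 + f)) <= s ^+ 4 / 16 * 4.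
    by rewrite ler_wpM2l // divr_ge0 // exprn_ge0 // ltW.
  lra.
have cb : -1 < c < 1 by apply: sqr_lt1_bounds; have := exprn_gt0 4 s0; lra.
have cb' : -1 <= c <= 1 by lra.
have a0 := acos_ge0 cb'; have a1 := acos_lepi cb'.
have /andP[_ hsin] :
    (pi - acos c) * cos (pi - acos c) <= sin (pi - acos c) <= pi - acos c.
  by apply: sin_bounds; lra.
have sE : sin (pi - acos c) = Num.sqrt (1 - c ^+ 2).
  by rewrite sinB sinpi cospi mul0r sin_acos //; ring.
have : s ^+ 2 / 4 <= Num.sqrt (1 - c ^+ 2).
  rewrite -ler_sqr ?nnegrE ?sqrtr_ge0 ?divr_ge0 ?sqr_ge0 // sqr_sqrtr; last first.
    by have := exprn_gt0 4 s0; lra.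
  by apply: le_trans hs; rewrite le_eqVlt; apply/orP; left; apply/eqP; field.
rewrite -sE; lra.
Qed.

(** * Angles of [T] and [F T] in terms of dot products *)

Definition truncated_chord {R : realType} (k d : R) : R :=
  Num.min (k * Num.sqrt (2 - 2 * d)) 1.

(** For unit vectors with these pairwise dot products, this is the square of their determinant. *)
Definition gram {R : realType} (d e f : R) : R :=
  1 + 2 * d * e * f - d ^+ 2 - e ^+ 2 - f ^+ 2.

(* The dot products of three distinct points on a circle of spherical radius [r],
   where [0 <= s <= cos r]. *)
Definition cap_dots {R : realType} (s d e f : R) : Prop :=
  [/\ -1 < d < 1, -1 < e < 1 & -1 < f < 1] /\
  [/\ 2 * s ^+ 2 - 1 <= d, 2 * s ^+ 2 - 1 <= e & 2 * s ^+ 2 - 1 <= f] /\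
  2 * s ^+ 2 * ((1 - d) * (1 - e) * (1 - f)) <= gram d e f.

Lemma gram_rot (R : realType) (d e f : R) : gram d e f = gram e f d.
Proof. by rewrite /gram; ring. Qed.

Lemma gram_swap (R : realType) (d e f : R) : gram d e f = gram d f e.
Proof. by rewrite /gram; ring. Qed.

Lemma cap_dots_rot (R : realType) (s d e f : R) :
  cap_dots s d e f -> cap_dots s e f d.
Proof.
move=> [[? ? ?] [[? ? ?]]]; rewrite gram_rot => h; split=> //; split=> //.
by have -> : (1 - e) * (1 - f) * (1 - d) = (1 - d) * (1 - e) * (1 - f) by ring.
Qed.

Lemma truncated_chord_gt0 (R : realType) (k d : R) :
  0 < k -> d < 1 -> 0 < truncated_chord k d.
Proof.
move=> k0 d1; rewrite /truncated_chord lt_min ltr01 andbT.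
by rewrite mulr_gt0 // sqrtr_gt0; lra.
Qed.

Lemma cap_dots_gram_gt0 (R : realType) (s d e f : R) :
  0 < s -> cap_dots s d e f -> 0 < gram d e f.
Proof.
move=> s0 [[hd he hf] [_]]; apply: lt_le_trans.
by rewrite !mulr_gt0 ?exprn_gt0 //; clear -hd he hf; lra.
Qed.

Lemma chord_lt_add (R : realType) (s d e f : R) :
  0 < s -> cap_dots s d e f ->
  Num.sqrt (2 - 2 * d) < Num.sqrt (2 - 2 * e) + Num.sqrt (2 - 2 * f).
Proof.
move=> s0 h; have G0 := cap_dots_gram_gt0 R s d e f s0 h.
have [[hd he hf] _] := h; clear h.
have p0 : 0 < (1 - d) * (1 - e) * (1 - f) by rewrite !mulr_gt0; lra.
apply: heron_lt_add; rewrite ?sqrtr_gt0; try lra.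
(* For chords [x], [y], [z], Heron's polynomial is
   [4 * gram d e f + x ^+ 2 * y ^+ 2 * z ^+ 2]. *)
rewrite !(exprM _ 2 2) !sqr_sqrtr; try lra.
rewrite /gram in G0; lra.
Qed.

Lemma truncated_chord_lt_add (R : realType) (k s d e f : R) :
  0 < k -> 0 < s -> cap_dots s d e f ->
  truncated_chord k d < truncated_chord k e + truncated_chord k f.
Proof.
move=> k0 s0 h; have [[hd he hf] _] := h.
apply: min1_lt_add.
- by rewrite mulr_gt0 // sqrtr_gt0; lra.
- by rewrite mulr_gt0 // sqrtr_gt0; lra.
- by rewrite -mulrDr ltr_pM2l //; exact: chord_lt_add h.
Qed.

Lemma truncated_cosine_bounds (R : realType) (k s d e f : R) :
  0 < k -> 0 < s -> cap_dots s d e f ->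
  -1 < (truncated_chord k e ^+ 2 + truncated_chord k f ^+ 2
            - truncated_chord k d ^+ 2)
           / (2 * (truncated_chord k e * truncated_chord k f)) < 1.
Proof.
move=> k0 s0 h.
have h1 := cap_dots_rot _ _ _ _ _ h; have h2 := cap_dots_rot _ _ _ _ _ h1.
have [[/andP[_ hd] /andP[_ he] /andP[_ hf]] _] := h.
apply: law_of_cosines_lt1; first exact: truncated_chord_gt0.
- exact: truncated_chord_gt0.
- exact: truncated_chord_lt_add h.
- exact: truncated_chord_lt_add h1.
- by rewrite addrC; exact: truncated_chord_lt_add h2.
Qed.

Lemma spherical_cosine_bounds (R : realType) (s d e f : R) :
  0 < s -> cap_dots s d e f ->
  -1 < (d - e * f) / (Num.sqrt (1 - e ^+ 2) * Num.sqrt (1 - f ^+ 2)) < 1.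
Proof.
move=> s0 h; have [[_ he hf] _] := h.
apply: sqr_lt1_bounds; rewrite spherical_sqr_sin //.
rewrite divr_gt0 //; first exact: cap_dots_gram_gt0 h.
by clear -he hf; rewrite mulr_gt0; nra.
Qed.

(** With [d = cos t], these are [x = 2 sin (t / 2)] and [m = cos (t / 2)], and the last clause is
    [sin t = x m]. *)
Lemma chord_cos_half (R : realType) (d : R) : -1 < d < 1 ->
  let x := Num.sqrt (2 - 2 * d) in let m := Num.sqrt ((1 + d) / 2) in
  [/\ 0 < x, 0 < m, x ^+ 2 = 2 - 2 * d, m ^+ 2 = 1 - x ^+ 2 / 4
    & Num.sqrt (1 - d ^+ 2) = x * m].
Proof.
move=> hd x m; have x2 : x ^+ 2 = 2 - 2 * d by rewrite sqr_sqrtr; lra.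
split; rewrite ?sqrtr_gt0 //; try lra.
- by rewrite x2 sqr_sqrtr; lra.
- by rewrite /x /m -sqrtrM; [congr Num.sqrt; field | lra].
Qed.

Lemma truncated_angle_ge_short (R : realType) (k s d e f : R) :
  0 < s <= 1 -> k * s = 2 -> cap_dots s d e f ->
  k * Num.sqrt (2 - 2 * d) <= 1 ->
  3 / 8 * acos ((d - e * f) / (Num.sqrt (1 - e ^+ 2) * Num.sqrt (1 - f ^+ 2)))
  <= acos ((truncated_chord k e ^+ 2 + truncated_chord k f ^+ 2
            - truncated_chord k d ^+ 2)
           / (2 * (truncated_chord k e * truncated_chord k f))).
Proof.
move=> hs ks h kz; have /andP[s0 s1] := hs.
have k0 : 0 < k by rewrite -(pmulr_lgt0 _ s0) ks.
have /andP[C0 C1] := truncated_cosine_bounds R k s d e f k0 s0 h.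
have /andP[c0 c1] := spherical_cosine_bounds R s d e f s0 h.
have h1 := cap_dots_rot _ _ _ _ _ h; have h2 := cap_dots_rot _ _ _ _ _ h1.
have [[hd he hf] [[_ es fs] _]] := h.
have Xp : 0 < truncated_chord k e by apply: truncated_chord_gt0; case/andP: he.
have Yp : 0 < truncated_chord k f by apply: truncated_chord_gt0; case/andP: hf.
apply: versine_ratio; rewrite ?acos_ge0 ?acos_lepi ?(ltW C0, ltW C1, ltW c0, ltW c1) //.
rewrite !acosK ?in_itv /= ?(ltW C0, ltW C1, ltW c0, ltW c1) //.
have hx := chord_lt_add _ _ _ _ _ s0 h1.
have hy := chord_lt_add _ _ _ _ _ s0 h2.
have [x0 m0 x2 m2 xm] := chord_cos_half _ _ he.
have [y0 n0 y2 n2 yn] := chord_cos_half _ _ hf.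
have [_ _ z2 _ _] := chord_cos_half _ _ hd.
have [dE eE fE] : [/\ d = 1 - Num.sqrt (2 - 2 * d) ^+ 2 / 2,
    e = 1 - Num.sqrt (2 - 2 * e) ^+ 2 / 2
    & f = 1 - Num.sqrt (2 - 2 * f) ^+ 2 / 2].
  by rewrite x2 y2 z2; split; field.
rewrite xm yn {1}dE {1}eE {1}fE.
(* The middle term is the common bound of [spherical_versine_le] and [contracted_versine_ge]. *)
apply: (@le_trans _ _ (9 / 16 *
  ((Num.sqrt (2 - 2 * d) ^+ 2
    - (Num.sqrt (2 - 2 * e) - Num.sqrt (2 - 2 * f)) ^+ 2)
   / (2 * (Num.sqrt (2 - 2 * e) * Num.sqrt ((1 + e) / 2)
     * (Num.sqrt (2 - 2 * f) * Num.sqrt ((1 + f) / 2))))))).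
  by rewrite ler_wpM2l //; exact: spherical_versine_le.
rewrite [truncated_chord k d]/truncated_chord (min_idPl kz).
apply: contracted_versine_ge => //.
- by apply: trunc_factor ks x0 m0 m2 _ => //; rewrite x2; clear -es; lra.
- by apply: trunc_factor ks y0 n0 n2 _ => //; rewrite y2; clear -fs; lra.
- by rewrite -exprMn mulrBr; exact: sqr_minB_le.
(* The triangle inequality for chords bounds the difference of two of them by the third. *)
by clear -hx hy; rewrite -subr_ge0 subr_sqr mulr_ge0; lra.
Qed.

Lemma truncated_angle_ge_pi3 (R : realType) (k s d e f : R) :
  0 < k -> 0 < s -> cap_dots s d e f ->
  1 <= k * Num.sqrt (2 - 2 * d) ->
  pi / 3 <= acos ((truncated_chord k e ^+ 2 + truncated_chord k f ^+ 2
            - truncated_chord k d ^+ 2)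
           / (2 * (truncated_chord k e * truncated_chord k f))).
Proof.
move=> k0 s0 h kz; have pi0 := pi_gt0 R.
have /andP[C0 C1] := truncated_cosine_bounds R k s d e f k0 s0 h.
have [[/andP[_ hd] /andP[_ he] /andP[_ hf]] _] := h.
rewrite -ler_cos ?acos_ge0 ?acos_lepi ?(ltW C0, ltW C1) //; last by clear -pi0; lra.
rewrite acosK ?in_itv /= ?(ltW C0, ltW C1) // cos_pi3.
rewrite [truncated_chord k d]/truncated_chord (min_idPr kz) expr1n.
have X0 := truncated_chord_gt0 R k e k0 he.
have Y0 := truncated_chord_gt0 R k f k0 hf.
have X1 : truncated_chord k e <= 1 by rewrite ge_min lexx orbT.
have Y1 : truncated_chord k f <= 1 by rewrite ge_min lexx orbT.
move: (truncated_chord k e) (truncated_chord k f) X0 Y0 X1 Y1 => X Y X0 Y0 X1 Y1.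
(* If [Y <= X], then [X ^ 2 <= 1] and [Y ^ 2 <= X Y], so [X ^ 2 + Y ^ 2 - 1 <= X Y]; the other case
   is symmetric. *)
clear -X0 Y0 X1 Y1; rewrite ler_pdivrMr ?mulr_gt0 //; nra.
Qed.

(** The constant serves both cases: [1 / 3 + s ^ 2 / 48 <= 3 / 8] because [s <= 1], and [(1 / 3 + s
    ^ 2 / 48) (pi - s ^ 2 / 4) <= pi / 3] because [pi < 4]. *)
Lemma truncated_angle_ge (R : realType) (k s d e f : R) :
  0 < s <= 1 -> k * s = 2 -> cap_dots s d e f ->
  (1 / 3 + s ^+ 2 / 48)
    * acos ((d - e * f) / (Num.sqrt (1 - e ^+ 2) * Num.sqrt (1 - f ^+ 2)))
  <= acos ((truncated_chord k e ^+ 2 + truncated_chord k f ^+ 2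
            - truncated_chord k d ^+ 2)
           / (2 * (truncated_chord k e * truncated_chord k f))).
Proof.
move=> hs ks h; have /andP[s0 s1] := hs.
have k0 : 0 < k by rewrite -(pmulr_lgt0 _ s0) ks.
have ss1 : s ^+ 2 <= 1 by rewrite expr_le1 // ltW.
have ss0 : 0 < s ^+ 2 by rewrite exprn_gt0.
have [kz|kz] := leP (k * Num.sqrt (2 - 2 * d)) 1.
  apply: le_trans (truncated_angle_ge_short _ _ _ _ _ _ hs ks h kz).
  have /andP[c0 c1] := spherical_cosine_bounds R s d e f s0 h.
  by rewrite ler_wpM2r ?acos_ge0 ?(ltW c0, ltW c1) //; clear -ss1; lra.
apply: le_trans (truncated_angle_ge_pi3 _ _ _ _ _ _ k0 s0 h (ltW kz)).
have [[hd he hf] [_ hG]] := h.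
have : acos ((d - e * f) / (Num.sqrt (1 - e ^+ 2) * Num.sqrt (1 - f ^+ 2)))
    <= pi - s ^+ 2 / 4.
  apply: (spherical_angle_far_from_pi _ _ _ _ _ _ hs ks hd he hf hG).
  rewrite -(@sqr_sqrtr _ (2 - 2 * d)); last by clear -hd; lra.
  by rewrite -exprMn expr_ge1 // ltW // (lt_trans _ kz).
have pi4 := pihalf_lt2 R.
move: (acos _) => t; clear -ss0 ss1 pi4 => ht.
have : (1 / 3 + s ^+ 2 / 48) * t <= (1 / 3 + s ^+ 2 / 48) * (pi - s ^+ 2 / 4).
  by rewrite ler_wpM2l //; lra.
nra.
Qed.

(* [all_analysis] exports another [edist]. *)
Local Notation edist := Defs.edist.

(** * Dot products and the planar and spherical laws of cosines *)

Lemma dotvC (R : realType) (n : nat) (u v : 'rV[R]_n) : dotv u v = dotv v u.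
Proof. by apply: eq_bigr => i _; rewrite mulrC. Qed.

Lemma dotvBl (R : realType) (n : nat) (u v w : 'rV[R]_n) :
  dotv (u - v) w = dotv u w - dotv v w.
Proof. by rewrite /dotv -sumrB; apply: eq_bigr => i _; rewrite !mxE mulrBl. Qed.

Lemma dotvBr (R : realType) (n : nat) (u v w : 'rV[R]_n) :
  dotv u (v - w) = dotv u v - dotv u w.
Proof. by rewrite dotvC dotvBl !(dotvC _ _ u). Qed.

Lemma dotvZl (R : realType) (n : nat) (a : R) (u v : 'rV[R]_n) :
  dotv (a *: u) v = a * dotv u v.
Proof. by rewrite /dotv mulr_sumr; apply: eq_bigr => i _; rewrite !mxE mulrA. Qed.

Lemma dotvZr (R : realType) (n : nat) (a : R) (u v : 'rV[R]_n) :
  dotv u (a *: v) = a * dotv u v.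
Proof. by rewrite dotvC dotvZl dotvC. Qed.

Lemma dotvv_ge0 (R : realType) (n : nat) (u : 'rV[R]_n) : 0 <= dotv u u.
Proof. by apply: sumr_ge0 => i _; rewrite -expr2 sqr_ge0. Qed.

Lemma sqr_norm2 (R : realType) (n : nat) (u : 'rV[R]_n) :
  norm2 u ^+ 2 = dotv u u.
Proof. by rewrite sqr_sqrtr // dotvv_ge0. Qed.

Lemma euclidean_distC (R : realType) (n : nat) (X Y : 'rV[R]_n) : edist X Y = edist Y X.
Proof. by rewrite /edist /norm2 !(dotvBl, dotvBr); congr Num.sqrt; ring. Qed.

Lemma eangleE (R : realType) (n : nat) (X Y Z : 'rV[R]_n) :
  eangle X Y Z = acos ((edist X Y ^+ 2 + edist Z X ^+ 2 - edist Y Z ^+ 2)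
                       / (2 * (edist X Y * edist Z X))).
Proof.
have -> : edist X Y ^+ 2 + edist Z X ^+ 2 - edist Y Z ^+ 2 =
    2 * dotv (Y - X) (Z - X).
  rewrite /edist !sqr_norm2 !(dotvBl, dotvBr) (dotvC _ _ Y X) (dotvC _ _ Z Y).
  by rewrite (dotvC _ _ Z X); ring.
by rewrite -mulf_div divff // mul1r (euclidean_distC _ _ X Y).
Qed.

Lemma dotvv_sphere (R : realType) (X : 'rV[R]_3) : on_sphere X -> dotv X X = 1.
Proof. by move=> h; rewrite -sqr_norm2 h expr1n. Qed.

Lemma dotv_sphere_bounds (R : realType) (X Y : 'rV[R]_3) :
  on_sphere X -> on_sphere Y -> -1 <= dotv X Y <= 1.
Proof.
move=> /dotvv_sphere hX /dotvv_sphere hY.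
have := dotvv_ge0 R 3 (X - Y); have := dotvv_ge0 R 3 (X - (-1) *: Y).
rewrite !(dotvBl, dotvBr, dotvZl, dotvZr) hX hY (dotvC _ _ Y X); lra.
Qed.

Lemma dotv_sphere_lt1 (R : realType) (X Y : 'rV[R]_3) :
  on_sphere X -> on_sphere Y -> 0 < sdist X Y < pi -> -1 < dotv X Y < 1.
Proof.
move=> hX hY; have := dotv_sphere_bounds R X Y hX hY; rewrite /sdist.
case/andP; rewrite !le_eqVlt => /predU1P[<-|->]; first by rewrite acosN1 ltxx andbF.
by case/predU1P => [->|->]; rewrite ?acos1 ?ltxx.
Qed.

Lemma sangleE (R : realType) (X Y Z : 'rV[R]_3) :
  on_sphere X -> on_sphere Y -> on_sphere Z ->
  sangle X Y Z = acos ((dotv Y Z - dotv X Y * dotv Z X)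
    / (Num.sqrt (1 - dotv X Y ^+ 2) * Num.sqrt (1 - dotv Z X ^+ 2))).
Proof.
move=> /dotvv_sphere hX /dotvv_sphere hY /dotvv_sphere hZ.
rewrite /sangle /vangle /norm2 !(dotvBl, dotvBr, dotvZl, dotvZr) hX hY hZ.
rewrite (dotvC _ _ Y X) (dotvC _ _ Z X).
by congr (acos (_ / (Num.sqrt _ * Num.sqrt _))); ring.
Qed.

Lemma Fstar_sdist (R : realType) (k : R) (X Y : 'rV[R]_3) :
  on_sphere X -> on_sphere Y ->
  Fstar k (sdist X Y) = truncated_chord k (dotv X Y).
Proof.
move=> hX hY; have hd := dotv_sphere_bounds R X Y hX hY.
have a0 := acos_ge0 hd; have a1 := acos_lepi hd.
have pi0 := pi_gt0 R.
congr (Num.min (k * _) 1); rewrite /chd.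
have s0 : 0 <= sin (sdist X Y / 2) by apply: sin_ge0_pi; rewrite /sdist; lra.
have := cos_half R (sdist X Y); rewrite acosK ?in_itv // => h.
have -> : 2 - 2 * dotv X Y = (2 * sin (sdist X Y / 2)) ^+ 2.
  by rewrite exprMn; lra.
by rewrite sqrtr_sqr ger0_norm // mulr_ge0.
Qed.

(** * Constraints imposed by the circumcentre *)

Lemma dotv3E (R : realType) (u v : 'rV[R]_3) :
  dotv u v = u 0 0 * v 0 0 + u 0 1 * v 0 1 + u 0 2%:R * v 0 2%:R.
Proof.
rewrite /dotv !big_ord_recr big_ord0 /= add0r.
by congr (_ * _ + _ * _ + _ * _); congr (_ 0 _); apply: val_inj.
Qed.

(* [D] is the determinant of [A], [B], [C] and [w] the normal
   [(B - A) x (C - A)] of their plane; Cramer's rule gives [D N = c w]. *)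
Lemma gram_circumcenter (R : realType) (A B C N : 'rV[R]_3) (c : R) :
  on_sphere A -> on_sphere B -> on_sphere C -> on_sphere N ->
  dotv N A = c -> dotv N B = c -> dotv N C = c ->
  2 * c ^+ 2 * ((1 - dotv B C) * (1 - dotv C A) * (1 - dotv A B))
    <= gram (dotv B C) (dotv C A) (dotv A B).
Proof.
move=> /dotvv_sphere hA /dotvv_sphere hB /dotvv_sphere hC /dotvv_sphere hN.
move=> NA NB NC.
pose cr (u v : 'rV[R]_3) (i j : 'I_3) : R := u 0 i * v 0 j - u 0 j * v 0 i.
pose w i j : R := cr B C i j + cr C A i j + cr A B i j.
pose D : R := A 0 0 * cr B C 1 2%:R + A 0 1 * cr B C 2%:R 0 + A 0 2%:R * cr B C 0 1.
have cw i j : c * w i j = dotv N A * cr B C i j + dotv N B * cr C A i j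
    + dotv N C * cr A B i j by rewrite NA NB NC /w; ring.
have w0 : D * N 0 0 = c * w 1 2%:R by rewrite cw !dotv3E /D /cr; ring.
have w1 : D * N 0 1 = c * w 2%:R 0 by rewrite cw !dotv3E /D /cr; ring.
have w2 : D * N 0 2%:R = c * w 0 1 by rewrite cw !dotv3E /D /cr; ring.
(* The intermediate identity holds for arbitrary vectors, so [ring] proves it in coordinates; the
   unit lengths enter afterwards. *)
have D2 : D ^+ 2 = gram (dotv B C) (dotv C A) (dotv A B).
  transitivity (dotv A A * dotv B B * dotv C C
    + 2 * dotv B C * dotv C A * dotv A B - dotv A A * dotv B C ^+ 2
    - dotv B B * dotv C A ^+ 2 - dotv C C * dotv A B ^+ 2).
    by rewrite !dotv3E /D /cr; ring.
  by rewrite hA hB hC /gram; ring.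
(* Lagrange's identity for the cross product of [B - A] and [C - A]. *)
have W2 : w 1 2%:R ^+ 2 + w 2%:R 0 ^+ 2 + w 0 1 ^+ 2 =
    gram (dotv B C) (dotv C A) (dotv A B)
    + 2 * ((1 - dotv B C) * (1 - dotv C A) * (1 - dotv A B)).
  transitivity ((dotv A A + dotv B B - 2 * dotv A B)
      * (dotv A A + dotv C C - 2 * dotv C A)
    - (dotv B C - dotv A B - dotv C A + dotv A A) ^+ 2).
    by rewrite !dotv3E /w /cr; ring.
  by rewrite hA hB hC /gram; ring.
have : D ^+ 2 * dotv N N =
    c ^+ 2 * (w 1 2%:R ^+ 2 + w 2%:R 0 ^+ 2 + w 0 1 ^+ 2).
  rewrite dotv3E !mulrDr -!expr2 -!exprMn w0 w1 w2; ring.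
(* With [G] the Gram determinant and [p] the product of the versines, this reads
   [G = c ^ 2 (G + 2 p)], and [c ^ 2 G >= 0]. *)
rewrite hN mulr1 W2 D2 mulrDr => ->.
have : 0 <= c ^+ 2 * gram (dotv B C) (dotv C A) (dotv A B).
  by rewrite -D2 mulr_ge0 ?sqr_ge0.
move: (c ^+ 2 * gram _ _ _) => g g0; rewrite -mulrA mulrCA; lra.
Qed.

(** The unit vector [(2 * c) *: N - B] is the point opposite to [B] on the circle; its dot product
    with [A], namely [2 * c ^+ 2 - dotv A B], is at most [1]. *)
Lemma dotv_ge_circumcenter (R : realType) (A B N : 'rV[R]_3) (c : R) :
  on_sphere A -> on_sphere B -> on_sphere N ->
  dotv N A = c -> dotv N B = c -> 2 * c ^+ 2 - 1 <= dotv A B.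
Proof.
move=> /dotvv_sphere hA /dotvv_sphere hB /dotvv_sphere hN NA NB.
have := dotvv_ge0 R 3 (A - ((2 * c) *: N - B)).
rewrite !(dotvBl, dotvBr, dotvZl, dotvZr) hA hB hN (dotvC _ _ B A).
rewrite (dotvC _ _ A N) (dotvC _ _ B N) NA NB; lra.
Qed.

(** * Realising side lengths in the plane *)

Lemma euclidean_triangle_exists (R : realType) (x y z : R) :
  0 < x -> 0 < y -> 0 < z -> x < y + z -> y < z + x -> z < x + y ->
  exists E : triangle R 2, euclidean_triangle E /\
    [/\ edist (vB E) (vC E) = x, edist (vC E) (vA E) = y
      & edist (vA E) (vB E) = z].
Proof.
move=> x0 y0 z0 hx hy hz.
have hy' : y < x + z by rewrite addrC.
have /andP[c1 c2] := law_of_cosines_lt1 R x y z x0 y0 hz hx hy'.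
set c := _ / _ in c1 c2.
(* [C] is the origin and [B] lies on the first axis; [c] is the cosine of the angle at [C], so [A]
   is [(u, v)]. *)
pose u := y * c.
have hu : 0 <= y ^+ 2 - u ^+ 2.
  have -> : y ^+ 2 - u ^+ 2 = y ^+ 2 * ((1 - c) * (1 + c)) by rewrite /u; ring.
  by rewrite mulr_ge0 ?sqr_ge0 // mulr_ge0; lra.
pose v := Num.sqrt (y ^+ 2 - u ^+ 2).
pose pt (a b : R) : 'rV[R]_2 := \row_(i < 2) [:: a; b]`_i.
have ptE a b a' b' : edist (pt a b) (pt a' b') =
    Num.sqrt ((a - a') ^+ 2 + (b - b') ^+ 2).
  by rewrite /edist /norm2 /dotv !big_ord_recr big_ord0 /= !mxE /= add0r.
have BC : edist (pt x 0) (pt 0 0) = x.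
  by rewrite ptE !subr0 expr0n addr0 sqrtr_sqr gtr0_norm.
have v2 : v ^+ 2 = y ^+ 2 - u ^+ 2 by rewrite sqr_sqrtr.
have CA : edist (pt 0 0) (pt u v) = y.
  by rewrite ptE !sub0r !sqrrN v2 addrC subrK sqrtr_sqr gtr0_norm.
have AB : edist (pt u v) (pt x 0) = z.
  rewrite ptE subr0 v2 -[RHS]gtr0_norm // -sqrtr_sqr; congr Num.sqrt.
  by rewrite /u /c; field; rewrite !gt_eqF.
have neq (X Y : 'rV[R]_2) : 0 < edist X Y -> X != Y.
  apply: contraTneq => ->; rewrite /edist subrr /norm2 /dotv big1 ?sqrtr0 ?ltxx //.
  by move=> i _; rewrite mxE mul0r.
have ang (X Y Z : 'rV[R]_2) : 0 < edist X Y -> 0 < edist Z X ->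
    edist Y Z < edist X Y + edist Z X ->
    edist X Y < edist Z X + edist Y Z -> edist Z X < edist X Y + edist Y Z ->
    0 < eangle X Y Z < pi.
  move=> h1 h2 h3 h4 h5; rewrite eangleE.
  have /andP[l1 l2] := law_of_cosines_lt1 _ _ _ _ h1 h2 h3 h4 h5.
  by rewrite acos_gt0 ?acos_ltpi ?l1 ?l2 ?(ltW l1) ?(ltW l2).
exists (Triangle (pt u v) (pt x 0) (pt 0 0)); split => //=.
clear -x0 y0 z0 hx hy hz neq ang AB BC CA.
by split; split; do [apply: neq | apply: ang]; rewrite ?AB ?BC ?CA //; lra.
Qed.

Theorem theorem1p6 (R : realType) (eps : R) (heps : 0 < eps < pi / 2) :
  exists k delta : R, 1 <= k /\ 0 < delta /\
    forall (T : triangle R 3) (r : R),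
      spherical_triangle T ->
      circumscribed_radius T r ->
      r <= pi / 2 - eps ->
      (exists E : triangle R 2, image_triangle (Fstar k) T E) /\
      (forall E : triangle R 2, image_triangle (Fstar k) T E ->
         1 / 3 + delta <= angle_distortion T E).
Proof.
have pi0 := pi_gt0 R.
pose s := sin eps.
have s0 : 0 < s by apply: sin_gt0_pihalf.
have s1 : s <= 1 by exact: sin_le1.
have hs : 0 < s <= 1 by rewrite s0.
have ks : 2 / s * s = 2 by rewrite divfK // gt_eqF.
have k0 : 0 < 2 / s by rewrite divr_gt0.
exists (2 / s), (s ^+ 2 / 48); split; first by rewrite ler_pdivlMr; lra.
split; first by rewrite divr_gt0 // exprn_gt0.
set k := 2 / s in ks k0 *.
move=> [A B C] r [[hA hB hC] [[dAB dBC dCA] [aA aB aC]]].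
move=> [N [hN [/= NA NB NC] _]] hr.
have nNA := dotv_sphere_bounds R N A hN hA.
have nNB := dotv_sphere_bounds R N B hN hB.
have nNC := dotv_sphere_bounds R N C hN hC.
have cosE (X : 'rV[R]_3) : -1 <= dotv N X <= 1 -> sdist N X = r ->
    dotv N X = cos r by move=> h <-; rewrite acosK ?in_itv.
have {}NB := cosE _ nNB NB.
have {}NC := cosE _ nNC NC.
have r0 : 0 <= r by rewrite -NA acos_ge0.
have {}NA := cosE _ nNA NA.
have sr : s <= cos r.
  (* [s] is the cosine of the largest radius allowed, and [cos] decreases on [[0, pi]]. *)
  have <- : cos (pi / 2 - eps) = s.
    by rewrite cosB cos_pihalf sin_pihalf mul0r add0r mul1r.
  by rewrite ler_cos; lra.
have sr2 : s ^+ 2 <= cos r ^+ 2 by rewrite ler_sqr ?nnegrE; lra.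
have {}dAB := dotv_sphere_lt1 R A B hA hB dAB.
have {}dBC := dotv_sphere_lt1 R B C hB hC dBC.
have {}dCA := dotv_sphere_lt1 R C A hC hA dCA.
have gAB := dotv_ge_circumcenter R A B N _ hA hB hN NA NB.
have gBC := dotv_ge_circumcenter R B C N _ hB hC hN NB NC.
have gCA := dotv_ge_circumcenter R C A N _ hC hA hN NC NA.
have hG := gram_circumcenter R A B C N _ hA hB hC hN NA NB NC.
(* The side opposite [A] comes first and the other two follow the order of [eangleE] and [sangleE],
   so the rotations of [hcap] serve the other two vertices. *)
have hcap : cap_dots s (dotv B C) (dotv A B) (dotv C A).
  have le1 (x : R) : -1 < x < 1 -> 0 <= 1 - x.
    by case/andP=> _ /ltW; rewrite subr_ge0.
  have sle (x : R) : 2 * cos r ^+ 2 - 1 <= x -> 2 * s ^+ 2 - 1 <= x.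
    by apply: le_trans; rewrite lerB // ler_pM2l.
  split; [by split | split; first by split; apply: sle].
  rewrite gram_swap [X in _ * X <= _]mulrAC.
  apply: le_trans hG; rewrite ler_wpM2r ?ler_pM2l //.
  by rewrite !mulr_ge0 // le1.
have hcap1 := cap_dots_rot _ _ _ _ _ hcap.
have hcap2 := cap_dots_rot _ _ _ _ _ hcap1.
have [[/andP[_ d1] /andP[_ f1] /andP[_ e1]] _] := hcap.
have FE := Fstar_sdist R k.
split.
  have [||||||E [hE [h1 h2 h3]]] := euclidean_triangle_exists R
    (truncated_chord k (dotv B C)) (truncated_chord k (dotv C A))
    (truncated_chord k (dotv A B)).
  - exact: truncated_chord_gt0.
  - exact: truncated_chord_gt0.
  - exact: truncated_chord_gt0.
  - by rewrite addrC; exact: truncated_chord_lt_add hcap.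
  - by rewrite addrC; exact: truncated_chord_lt_add hcap2.
  - by rewrite addrC; exact: truncated_chord_lt_add hcap1.
  by exists E; split; rewrite //= !FE.
move=> E [_ [/=]]; rewrite !FE // => EBC ECA EAB.
rewrite /angle_distortion /= !le_min.
have [/andP[aA0 _] /andP[aB0 _] /andP[aC0 _]] := And3 aA aB aC.
rewrite !ler_pdivlMr // !eangleE EBC ECA EAB !sangleE //.
by apply/and3P; split; apply: truncated_angle_ge.
Qed.
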